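(* Let $\mu$ be a finite Borel measure on $\mathbb{R}$ that is continuous (has no atoms). Let $m>1>\varsigma>0$ be real numbers. Assume that there exists a Borel set $A\subset\mathbb{R}$ with $\mu(A)>0$ such that for all $x\in A$, $$\liminf_{\epsilon\to0+}\epsilon^{-\varsigma}J_{\mu,m}(x,\epsilon)>0.$$ Then for all $q\ge1+\frac1m$, $$D_\mu^+(q)\le\varsigma.$$
   Context: For $m>0$, $x\in\mathbb{R}$, $\epsilon>0$, the $m$-Borel transform of $\mu$ is $J_{\mu,m}(x,\epsilon)=\epsilon^m\int_{\mathbb{R}}\frac{d\mu(y)}{|x-y|^m+\epsilon^m}$. For $q>0$ and $\epsilon>0$, let $S_\mu(q,\epsilon)=\sum_{j\in\mathbb{Z}}\big(\mu([j\epsilon,(j+1)\epsilon))\big)^q$. The upper multifractal dimension is $D_\mu^+(q)=\limsup_{\epsilon\to0+}\frac{\log S_\mu(q,\epsilon)}{(q-1)\log\epsilon}$. *)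

(* Defs.v *)
From HB Require Import structures.
From mathcomp Require Import all_boot all_order all_algebra.
From mathcomp Require Import all_classical all_reals all_analysis.

Set Implicit Arguments.
Unset Strict Implicit.
Unset Printing Implicit Defensive.

Import Order.TTheory GRing.Theory Num.Theory.
Import numFieldNormedType.Exports.

Local Open Scope classical_set_scope.
Local Open Scope ring_scope.
Local Open Scope ereal_scope.

(* [measurableTypeR R] is the real line with its Borel sigma-algebra
   (generated by the intervals ]a, b]). *)

Definition borel_transform (R : realType)
    (mu : {measure set (measurableTypeR R) -> \bar R}) (m x eps : R) : \bar R :=
  (eps `^ m)%:E *
    \int[mu]_(y in setT) ((`|x - y| `^ m + eps `^ m)^-1)%:E.

(* Extended-real valued: for 0 < q < 1 the sum may be infinite. *)
Definition partition_sum (R : realType)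
    (mu : {measure set (measurableTypeR R) -> \bar R}) (q eps : R) : \bar R :=
  \esum_(j in [set: int])
    (mu [set` `[(j%:~R * eps)%R, ((j + 1)%:~R * eps)%R[ ] `^ q).

Definition upper_multifractal_dim (R : realType)
    (mu : {measure set (measurableTypeR R) -> \bar R}) (q : R) : \bar R :=
  limf_esup
    (fun eps : R => lne (partition_sum mu q eps) / ((q - 1) * ln eps)%:E)
    0%R^'+.

Definition continuous_measure (R : realType)
    (mu : {measure set (measurableTypeR R) -> \bar R}) : Prop :=
  forall x : R, mu [set x] = 0.

(* Main.v *)
Require Import Defs.
From HB Require Import structures.
From mathcomp Require Import all_boot all_order all_algebra.
From mathcomp Require Import all_classical all_reals all_analysis.
From mathcomp Require Import measurable_realfun ring lra zify.

Set Implicit Arguments.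
Unset Strict Implicit.
Unset Printing Implicit Defensive.

Import Order.TTheory GRing.Theory Num.Theory.
Import numFieldNormedType.Exports.

Local Open Scope classical_set_scope.
Local Open Scope ring_scope.
Local Open Scope ereal_scope.

(* Put r = 1/m and let u_j be the masses of the cells [j eps, (j+1) eps).  For x
   in cell j, the kernel is at most 3^m (1+e)^(-m) on the cells at distance e,
   so J(x, eps) <= 3^m \sum_(e < n) (1+e)^(-m) (u_(j+e) + u_(j-e)) + tail, and
   the tail is below half of the assumed lower bound l eps^s once n is of order
   1/eps.  Taking r-th powers (r < 1 is subadditive) turns the weights into
   1/(1+e).  Multiplying by u_j, using a b^r <= a^(1+r) + b^(1+r) and summing
   over the cells meeting the good set gives
   S(1+r, eps) >= C eps^(s r) / log(1/eps); the logarithm is the price of the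
   critical exponent q = 1+r and does not affect the dimension.  Larger q follow
   by interpolating u^(1+r) between u and u^q. *)

(** * Elementary inequalities for powers and harmonic sums *)

(** The fractions a/(a+b) and b/(a+b) lie in [0, 1], where t <= t^r. They add up to 1, so scaling by
    (a+b)^r and summing gives the bound; a + b = 0 is handled apart. *)
Lemma powRD_le (R : realType) (r a b : R) : (0 <= r <= 1)%R ->
  (0 <= a)%R -> (0 <= b)%R -> ((a + b) `^ r <= a `^ r + b `^ r)%R.
Proof.
move=> /andP[r0 r1] a0 b0; have := addr_ge0 a0 b0.
rewrite le_eqVlt => /predU1P[ab0|ab_gt0].
  rewrite -ab0; have /eqP : (a + b = 0)%R by rewrite -ab0.
  rewrite paddr_eq0// => /andP[/eqP-> /eqP->].
  by rewrite lerDl powR_ge0.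
have le_frac t : (0 <= t <= a + b)%R ->
    (t / (a + b) * (a + b) `^ r <= t `^ r)%R.
  move=> /andP[]; rewrite le_eqVlt => /predU1P[<-|t0] tab.
    by rewrite !mul0r powR_ge0.
  have u0 : (0 < t / (a + b))%R by rewrite divr_gt0.
  rewrite -[in leRHS](divfK (lt0r_neq0 ab_gt0) t) powRM ?(ltW u0) ?(ltW ab_gt0)//.
  rewrite ler_wpM2r ?powR_ge0//.
  by rewrite ger1_powR// u0 ler_pdivrMr// mul1r.
have := lerD (le_frac a _) (le_frac b _).
by rewrite -!mulrDl divff ?lt0r_neq0// mul1r a0 b0 lerDl lerDr a0 b0; exact.
Qed.

Lemma powR_sum_le (R : realType) (r : R) (I : Type) (s : seq I) (f : I -> R) :
  (0 < r <= 1)%R -> (forall i, 0 <= f i)%R ->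
  ((\sum_(i <- s) f i) `^ r <= \sum_(i <- s) f i `^ r)%R.
Proof.
move=> /andP[r0 r1] f0; elim: s => [|i s IH].
  (* Here [0 < r] is essential: a zero exponent would turn the empty sum into 1. *)
  by rewrite !big_nil powR0// gt_eqF.
rewrite !big_cons; apply: le_trans (powRD_le _ (f0 i) (sumr_ge0 _ _)) _ => //.
  by rewrite (ltW r0).
by rewrite lerD2l.
Qed.

(** The product is at most the larger of [a] and [b] raised to 1 + r, and this is one of the two
    summands. *)
Lemma mulr_powR_le (R : realType) (r a b : R) : (0 < r)%R ->
  (0 <= a)%R -> (0 <= b)%R -> (a * b `^ r <= a `^ (1 + r) + b `^ (1 + r))%R.
Proof.
move=> r0 a0 b0; have mE c : (0 <= c)%R -> (c `^ (1 + r) = c * c `^ r)%R.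
  by move=> c0; rewrite powRD ?powRr1// gt_eqF// ltr_wpDl.
have [ab|ba] := leP a b.
  by rewrite (mE b)// ler_wpDl ?powR_ge0// ler_wpM2r ?powR_ge0.
rewrite (mE a)// ler_wpDr ?powR_ge0// ler_wpM2l// ge0_ler_powR// ?ltW//.
Qed.

(** The threshold [l] stays free: summed over cells, the linear term costs [l] times the total mass,
    and [l] is later chosen so small that this cost can be absorbed. *)
Lemma powR_interpolation (R : realType) (r q l a : R) : (0 < r)%R ->
  (1 + r <= q)%R -> (0 < l)%R -> (0 <= a)%R ->
  (a `^ (1 + r) <= l * a + l `^ (- ((q - (1 + r)) / r)) * a `^ q)%R.
Proof.
move=> r0 rq l0 a0; have [->|a_neq0] := eqVneq a 0%R.
  rewrite powR0; last by rewrite gt_eqF// addr_gt0.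
  by rewrite mulr0 add0r mulr_ge0 ?powR_ge0.
have a_gt0 : (0 < a)%R by rewrite lt0r a_neq0.
(* If a^r <= l, the first term dominates, otherwise the second one. *)
have [al|la] := leP (a `^ r)%R l.
  rewrite ler_wpDr ?mulr_ge0 ?powR_ge0// powRD ?a_neq0 ?implybT// powRr1//.
  by rewrite mulrC ler_wpM2r.
rewrite ler_wpDl ?mulr_ge0 ?(ltW l0)//.
have -> : (a `^ q = a `^ (1 + r) * a `^ (q - (1 + r)))%R.
  by rewrite -powRD ?a_neq0 ?implybT// subrKC.
rewrite mulrCA ler_peMr ?powR_ge0//.
rewrite powRN ler_pdivlMl ?powR_gt0// mulr1.
have -> : (a `^ (q - (1 + r)) = (a `^ r) `^ ((q - (1 + r)) / r))%R.
  by rewrite -powRrM mulrC divfK// gt_eqF.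
apply: ge0_ler_powR; rewrite ?nnegrE ?powR_ge0 ?(ltW l0) ?(ltW la)//.
by rewrite divr_ge0 ?subr_ge0 ?(ltW r0).
Qed.

(** The induction step 1/(n+2) <= ln((n+2)/(n+1)) is ln(1+x) <= x at x = -1/(n+2). *)
Lemma harmonic_sum_le (R : realType) (n : nat) :
  (\sum_(e < n.+1) e.+1%:R^-1 <= 1 + ln n.+1%:R :> R)%R.
Proof.
elim: n => [|n IH]; first by rewrite big_ord1 invr1 lerDl ln_ge0.
rewrite big_ord_recr/=; apply: le_trans (lerD IH (lexx _)) _.
rewrite -addrA lerD2l.
have h : (0 < n.+1%:R / n.+2%:R :> R)%R by rewrite divr_gt0.
have := @le_ln1Dx R (n.+1%:R / n.+2%:R - 1)%R.
rewrite ltrBrDr addNr h => /(_ isT); rewrite subrKC.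
rewrite ln_div ?posrE// lerBlDl => /le_trans; rewrite -lerBrDr; apply.
rewrite lerD2l -opprB lerN2 -[X in (X - _)%R](@divff _ n.+2%:R)//.
by rewrite -mulrBl -natrB// subSnn mul1r.
Qed.

(** * Sums over integers and other countable index sets *)

Lemma ge0_esumZl (R : realType) (T : choiceType) (D : set T) (k : R)
    (a : T -> \bar R) : (0 <= k)%R -> (forall i, 0 <= a i) ->
  \esum_(i in D) (k%:E * a i) = k%:E * \esum_(i in D) a i.
Proof.
move=> k0 a0; rewrite /esum -ereal_supZl//; last first.
  apply/set0P; exists 0; exists set0; first exact: fsets_set0.
  by rewrite fsbig_set0.
congr ereal_sup; rewrite image_comp; apply: eq_imagel => A _ /=.
by rewrite ge0_mule_fsumr.
Qed.

Lemma ge0_esum_le_setT (R : realType) (T : choiceType) (D : set T)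
    (a : T -> \bar R) : (forall i, 0 <= a i) ->
  \esum_(i in D) a i <= \esum_(i in [set: T]) a i.
Proof. by move=> a0; rewrite esum_mkcond; apply: le_esum => i _; case: ifP. Qed.

Lemma esum_int_shift (R : realType) (a : int -> \bar R) (k : int) :
  \esum_(j in [set: int]) a (j + k)%R = \esum_(j in [set: int]) a j.
Proof.
symmetry; rewrite (@reindex_esum _ _ _ setT _ (fun j : int => j + k)%R)//.
split=> // [i j _ _ /addIr//|j _]; exists (j - k)%R => //.
by rewrite subrK.
Qed.

(** Each of the two products with [u j] splits into two (1+r)-th powers, and translation invariance
    gives all four the same sum over the integers: hence the factor 4. The sum over [D] is first
    enlarged to all integers, since shifts need not preserve [D]. *)
Lemma convolution_esum_le (R : realType) (r k : R) (n : nat) (D : set int)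
    (u : int -> R) : (0 < r)%R -> (forall j, 0 <= u j)%R ->
  (forall j, D j -> k <= \sum_(e < n)
    e.+1%:R^-1 * (u (j + e%:Z) `^ r + u (j - e%:Z) `^ r))%R ->
  \esum_(j in D) (k * u j)%:E <=
  (4 * \sum_(e < n) e.+1%:R^-1)%:E *
    \esum_(j in [set: int]) (u j `^ (1 + r))%:E.
Proof.
move=> r0 u0 kle; pose v j := (u j `^ (1 + r))%R.
have v0 j : 0 <= (v j)%:E by rewrite lee_fin powR_ge0.
apply: (@le_trans _ _ (\esum_(j in D) \sum_(e < n) (e.+1%:R^-1)%:E *
    ((v j)%:E + (v j)%:E + (v (j + e%:Z)%R)%:E + (v (j - e%:Z)%R)%:E))).
  apply: le_esum => j Dj; rewrite -!EFinD.
  under eq_bigr do rewrite -!EFinD -EFinM.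
  rewrite sumEFin lee_fin.
  apply: le_trans (ler_wpM2r (u0 j) (kle _ Dj)) _; rewrite mulr_suml.
  apply: ler_sum => e _; rewrite -mulrA ler_wpM2l// mulrDl -addrA addrACA.
  by rewrite mulrC [X in (_ + X)%R]mulrC lerD// mulr_powR_le.
have t0 (e : 'I_n) j : 0 <= (e.+1%:R^-1)%:E *
    ((v j)%:E + (v j)%:E + (v (j + e%:Z)%R)%:E + (v (j - e%:Z)%R)%:E).
  by rewrite mule_ge0 ?adde_ge0 ?v0// lee_fin.
apply: le_trans (ge0_esum_le_setT _ _) _ => [j|]; first exact: sume_ge0.
rewrite esum_sum// mulr_sumr -sumEFin ge0_sume_distrl; last first.
  by move=> e _; rewrite lee_fin.
apply: lee_sum => e _.
rewrite ge0_esumZl//; last by move=> j; rewrite ?adde_ge0.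
rewrite !esumD//; do ?by move=> j _; rewrite ?adde_ge0.
rewrite (esum_int_shift (fun j => (v j)%:E)).
rewrite (esum_int_shift (fun j => (v j)%:E)).
rewrite mulrC EFinM -muleA lee_wpmul2l ?lee_fin//.
by rewrite mule_natl 2!muleS mule2n !addeA.
Qed.

(** Countable additivity over the naturals is transported to [I] through [pickle]; the auxiliary [G]
    is empty at numbers that code no index. *)
Lemma measure_bigcup_esum d (R : realType) (T : measurableType d)
    (mu : {measure set T -> \bar R}) (I : countType) (D : set I)
    (F : I -> set T) : (forall i, measurable (F i)) -> trivIset setT F ->
  mu (\bigcup_(i in D) F i) = \esum_(i in D) mu (F i).
Proof.
move=> mF tF; pose G n := if unpickle n is Some i then F i else set0.
have GE i : G (pickle i) = F i by rewrite /G pickleK.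
have -> : \bigcup_(i in D) F i = \bigcup_(n in pickle @` D) G n.
  by rewrite bigcup_image; apply: eq_bigcupr => i _; rewrite GE.
rewrite measure_bigcup; last 2 first.
- by move=> _ [i _ <-]; rewrite GE.
- move=> _ _ [i _ <-] [j _ <-]; rewrite !GE => ij; congr pickle.
  exact: tF.
rewrite nneseries_esum// set_mem_set esum_image.
  by apply: eq_esum => i _; rewrite GE.
by move=> i j _ _; exact: (pcan_inj pickleK).
Qed.

(** * Grid cells and the Borel transform seen through them *)

Definition cell (R : realType) (eps : R) (j : int) : set (measurableTypeR R) :=
  [set` `[(j%:~R * eps)%R, ((j + 1)%:~R * eps)%R[ ].

(** The constant comes from (1+e) eps <= 3 max(eps, |x-y|): the term eps suffices for e <= 2, while
    |x-y| >= (e-1) eps suffices for e >= 3. The m-th power of the maximum is at most the denominator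
    of the kernel. *)
Lemma cell_kernel_le (R : realType) (m eps x y : R) (j k : int) (e : nat) :
  (0 <= m)%R -> (0 < eps)%R -> cell eps j x -> cell eps k y ->
  (e <= `|k - j|)%N ->
  (eps `^ m * (`|x - y| `^ m + eps `^ m)^-1 <= 3 `^ m * e.+1%:R `^ (- m))%R.
Proof.
move=> m0 eps0; rewrite /cell/= !in_itv/= !intrD => /andP[jx xj] /andP[ky yk] ejk.
have e_dist : ((e%:R - 1) * eps <= `|x - y|)%R.
  have [kj|jk] := leP j k.
    rewrite distrC; apply: le_trans (ler_norm _).
    have : (e%:R <= k%:~R - j%:~R :> R)%R.
      by rewrite -intrB -[e%:R]/(e%:~R) ler_int; lia.
    by move/(ler_wpM2r (ltW eps0)); lra.
  apply: le_trans (ler_norm _).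
  have : (e%:R <= j%:~R - k%:~R :> R)%R.
    by rewrite -intrB -[e%:R]/(e%:~R) ler_int; lia.
  by move/(ler_wpM2r (ltW eps0)); lra.
set M := (3 * Num.max eps `|x - y|)%R.
have eM : (e.+1%:R * eps <= M)%R.
  rewrite /M maxr_pMr//; have [e2|e2] := leqP e 2.
    by rewrite le_max ler_wpM2r ?(ltW eps0)// ler_nat.
  rewrite le_max; apply/orP; right.
  apply: le_trans (ler_wpM2l _ e_dist) => //.
  rewrite mulrA ler_wpM2r ?(ltW eps0)// -natr1.
  have : (3 <= e%:R :> R)%R by rewrite ler_nat.
  by lra.
have epsm : (0 < eps `^ m)%R by rewrite powR_gt0.
rewrite ler_pdivrMr; last by rewrite ltr_wpDl ?powR_ge0.
rewrite powRN mulrAC ler_pdivlMr ?powR_gt0// mulrC -powRM ?(ltW eps0)//.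
apply: (@le_trans _ _ (M `^ m)%R).
  apply: ge0_ler_powR => //; rewrite nnegrE ?mulr_ge0 ?(ltW eps0)//.
  by rewrite le_max ?(ltW eps0).
rewrite /M powRM ?le_max ?(ltW eps0)// ler_wpM2l ?powR_ge0//.
by case: (leP eps) => _; [rewrite lerDl|rewrite lerDr]; exact: powR_ge0.
Qed.

Lemma measurable_cell (R : realType) (eps : R) (j : int) :
  measurable (cell eps j).
Proof. exact: measurable_itv. Qed.

Lemma cell_floor (R : realType) (eps : R) (x : measurableTypeR R) :
  (0 < eps)%R -> cell eps (Num.floor (x / eps)%R) x.
Proof.
move=> eps0; rewrite /cell/= in_itv/= -ler_pdivlMr// -ltr_pdivrMr//.
exact: floor_itv.
Qed.

Lemma cell_inj (R : realType) (eps : R) (i j : int) x : (0 < eps)%R ->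
  cell eps i x -> cell eps j x -> i = j.
Proof.
move=> eps0; rewrite /cell/= !in_itv/= -!ler_pdivlMr// -!ltr_pdivrMr//.
move=> /andP[ix xi] /andP[jx xj].
have := le_lt_trans ix xj; have := le_lt_trans jx xi.
by rewrite !ltr_int; lia.
Qed.

Lemma trivIset_cell (R : realType) (eps : R) : (0 < eps)%R ->
  trivIset setT (cell eps).
Proof. by move=> eps0 i j _ _ [x [ix jx]]; exact: cell_inj ix jx. Qed.

Lemma bigcup_cell (R : realType) (eps : R) : (0 < eps)%R ->
  \bigcup_j cell eps j = setT.
Proof.
move=> eps0; apply/seteqP; split=> // x _.
by eexists; [|exact: (cell_floor x eps0)].
Qed.

Lemma measurable_kernel (R : realType) (m eps x : R) : (0 < eps)%R ->
  measurable_fun setT (fun y : measurableTypeR R =>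
    ((`|x - y| `^ m + eps `^ m)^-1)%R).
Proof.
move=> eps0; rewrite (_ : (fun _ => _) =
    (@powR R ^~ (-1)%R) \o (fun y => `|x - y| `^ m + eps `^ m)%R); last first.
  by apply/funext => y /=; rewrite powR_inv1// addr_ge0 ?powR_ge0.
apply: measurableT_comp; first exact: measurable_powR.
apply: measurable_funD => //.
apply: (measurableT_comp (measurable_powR m)).
apply: measurableT_comp; first exact: normr_measurable.
by apply: measurable_funB.
Qed.

(* The cell of index j is counted twice, by e = 0. *)
Lemma borel_transform_cell_le (R : realType)
    (mu : {measure set (measurableTypeR R) -> \bar R}) (m eps x : R)
    (j : int) (n : nat) : (0 <= m)%R -> (0 < eps)%R -> cell eps j x ->
  borel_transform mu m x eps <=
  (3 `^ m)%:E * (\sum_(e < n) (e.+1%:R `^ (- m))%:E *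
      (mu (cell eps (j + e%:Z)%R) + mu (cell eps (j - e%:Z)%R)) +
    (n.+1%:R `^ (- m))%:E * mu setT).
Proof.
move=> m0 eps0 jx; rewrite /borel_transform.
have mk := measurable_kernel m x eps0.
have mc := measurable_cell eps.
(* A step-function majorant of the kernel: [g e] lives on the two cells at distance e, and an added
   constant will cover all cells at distance n or more. *)
pose g (e : nat) (y : measurableTypeR R) : \bar R := (e.+1%:R `^ (- m))%:E *
  ((\1_(cell eps (j + e%:Z)%R) y)%:E + (\1_(cell eps (j - e%:Z)%R) y)%:E).
have mi (A : set (measurableTypeR R)) : measurable A ->
    measurable_fun setT (fun y : measurableTypeR R => (\1_A y)%:E : \bar R).
  by move=> mA; apply/measurable_EFinP; exact: measurable_indic.
have g0 e y : 0 <= g e y by rewrite mule_ge0 ?adde_ge0 ?lee_fin// powR_ge0.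
have mg e : measurable_fun setT (g e).
  by apply: emeasurable_funM => //; apply: emeasurable_funD; exact: mi.
have ms : measurable_fun setT (fun y => \sum_(e < n) g e y).
  by apply: emeasurable_sum => e; exact: mg.
rewrite -ge0_integralZl ?lee_fin ?powR_ge0//; last 2 first.
- exact/measurable_EFinP.
- by move=> y _; rewrite lee_fin invr_ge0 addr_ge0 ?powR_ge0.
have -> : \sum_(e < n) (e.+1%:R `^ (- m))%:E *
      (mu (cell eps (j + e%:Z)%R) + mu (cell eps (j - e%:Z)%R)) +
    (n.+1%:R `^ (- m))%:E * mu setT =
    \int[mu]_y (\sum_(e < n) g e y + (n.+1%:R `^ (- m))%:E).
  rewrite ge0_integralD//; try by move=> y _; rewrite ?sume_ge0// lee_fin powR_ge0.
  rewrite integral_cst// ge0_integral_sum//; congr (_ + _).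
  apply: eq_bigr => e _; rewrite ge0_integralZl ?lee_fin ?powR_ge0//; last 2 first.
  - by apply: emeasurable_funD; exact: mi.
  - by move=> y _; rewrite adde_ge0 ?lee_fin.
  rewrite ge0_integralD//; [|exact: mi|exact: mi].
  by rewrite !integral_indic// !setIT.
rewrite -ge0_integralZl ?lee_fin ?powR_ge0//; last 2 first.
- by apply: emeasurable_funD => //; exact: ms.
- by move=> y _; rewrite adde_ge0 ?sume_ge0// lee_fin powR_ge0.
apply: ge0_le_integral => //.
- by move=> y _; rewrite lee_fin mulr_ge0 ?invr_ge0 ?addr_ge0 ?powR_ge0.
- by apply/measurable_EFinP; apply: measurable_funM.
- apply: emeasurable_funM => //.
  by apply: emeasurable_funD => //; exact: ms.
move=> y _; set k := Num.floor (y / eps)%R.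
have ky : cell eps k y by exact: cell_floor.
have bd e : (e <= `|k - j|)%N -> ((eps `^ m)%:E *
    ((`|x - y| `^ m + eps `^ m)^-1)%:E <= (3 `^ m)%:E * (e.+1%:R `^ (- m))%:E).
  by move=> /(cell_kernel_le m0 eps0 jx ky) ?; rewrite -!EFinM lee_fin.
(* Far cells are controlled by the constant alone, near cells by the single summand whose index is
   the distance |k - j|. *)
have [n_le|lt_n] := leqP n `|k - j|.
  apply: le_trans (bd _ n_le) _; rewrite lee_wpmul2l ?lee_fin ?powR_ge0//.
  by rewrite leeDr// sume_ge0.
apply: le_trans (bd _ (leqnn _)) _; rewrite lee_wpmul2l ?lee_fin ?powR_ge0//.
rewrite (bigD1 (Ordinal lt_n))//= -addeA.
apply: (@le_trans _ _ (g `|k - j|%N y)); last first.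
  by rewrite leeDl// adde_ge0 ?sume_ge0// lee_fin powR_ge0.
rewrite /g -{1}[(_ `^ _)%:E]mule1 lee_wpmul2l ?lee_fin ?powR_ge0//.
have [kj|jk] := leP j k.
  rewrite !indicE mem_set ?lerDl//.
  by rewrite (_ : (j + _)%R = k)//; lia.
rewrite !indicE [_ \in cell eps (j - _)%R]mem_set ?lerDr//.
by rewrite (_ : (j - _)%R = k)//; lia.
Qed.

(** * Lower bounds for the partition sums, down to small scales *)

(** The tail takes at most half of [c]. On the other half, the power 1/m passes inside the sum by
    subadditivity and turns 3^m into 3 and (1+e)^(-m) into 1/(1+e). *)
Lemma cell_sum_ge (R : realType)
    (mu : {measure set (measurableTypeR R) -> \bar R}) (m c eps x : R)
    (j : int) (n : nat) : fin_num_fun mu -> (1 < m)%R -> (0 < eps)%R -> (0 < c)%R ->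
  (3 `^ m * (n.+1%:R `^ (- m) * fine (mu setT)) <= c / 2)%R ->
  cell eps j x -> c%:E <= borel_transform mu m x eps ->
  ((c / 2) `^ m^-1 / 3 <= \sum_(e < n) e.+1%:R^-1 *
     (fine (mu (cell eps (j + e%:Z)%R)) `^ m^-1 +
      fine (mu (cell eps (j - e%:Z)%R)) `^ m^-1))%R.
Proof.
move=> mufin m1 eps0 c0 tail jx cJ; have m0 : (0 < m)%R by exact: lt_trans m1.
have r01 : (0 < m^-1 <= 1)%R by rewrite invr_gt0 m0 invf_le1// ltW.
have mur k : mu (cell eps k) = (fine (mu (cell eps k)))%:E.
  by rewrite fineK// mufin//; exact: measurable_cell.
have mu0 k : (0 <= fine (mu (cell eps k)))%R by rewrite fine_ge0.
set u := fun k => fine (mu (cell eps k)).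
have c_le : (c / 2 <= 3 `^ m * \sum_(e < n)
    e.+1%:R `^ (- m) * (u (j + e%:Z) + u (j - e%:Z)))%R.
  have := le_trans cJ (borel_transform_cell_le mu n (ltW m0) eps0 jx).
  under eq_bigr => e _ do rewrite (mur (j + e%:Z)%R) (mur (j - e%:Z)%R) -EFinD -EFinM.
  rewrite -[mu setT]fineK ?mufin// sumEFin -(EFinM _ (fine _)) -EFinD -EFinM lee_fin.
  by rewrite -/u mulrDr => h; lra.
have S0 : (0 <= \sum_(e < n) e.+1%:R `^ (- m) * (u (j + e%:Z) + u (j - e%:Z)))%R.
  by apply: sumr_ge0 => e _; rewrite mulr_ge0 ?powR_ge0// addr_ge0 ?mu0.
have := ge0_ler_powR (ltW (andP r01).1) _ _ c_le.
rewrite !nnegrE divr_ge0 ?(ltW c0)// mulr_ge0 ?powR_ge0//.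
move=> /(_ isT isT); rewrite [((3 `^ m * _) `^ _)%R]powRM ?powR_ge0//.
rewrite -powRrM mulfV ?gt_eqF// powRr1// => /le_trans h.
rewrite ler_pdivrMr// [leRHS]mulrC; apply: h; rewrite ler_wpM2l//.
apply: le_trans (powR_sum_le _ r01 _) _ => [e|].
  by rewrite mulr_ge0 ?powR_ge0// addr_ge0 ?mu0.
apply: ler_sum => e _; rewrite powRM ?powR_ge0 ?addr_ge0 ?mu0//.
rewrite -powRrM mulNr mulfV ?gt_eqF// powR_inv1// ler_wpM2l//.
by apply: powRD_le; rewrite ?mu0// (ltW (andP r01).1) (andP r01).2.
Qed.

Lemma partition_sum_esum (R : realType)
    (mu : {measure set (measurableTypeR R) -> \bar R}) (q eps : R) : fin_num_fun mu ->
  partition_sum mu q eps =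
  \esum_(j in [set: int]) (fine (mu (cell eps j)) `^ q)%:E.
Proof.
move=> mufin; apply: eq_esum => j _.
by rewrite -poweR_EFin fineK// mufin//; exact: measurable_cell.
Qed.

Lemma partition_sum_ge (R : realType)
    (mu : {measure set (measurableTypeR R) -> \bar R}) (m c eps : R)
    (n : nat) (B : set (measurableTypeR R)) :
  fin_num_fun mu -> (1 < m)%R -> (0 < eps)%R -> (0 < c)%R ->
  (3 `^ m * (n.+1%:R `^ (- m) * fine (mu setT)) <= c / 2)%R ->
  (forall x, B x -> c%:E <= borel_transform mu m x eps) ->
  ((c / 2) `^ m^-1 / 3)%:E * mu_ext mu B <=
  (4 * \sum_(e < n) e.+1%:R^-1)%:E * partition_sum mu (1 + m^-1) eps.
Proof.
(* The cells indexed by [D] cover [B] and have a measurable union, so their total mass dominates the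
   outer measure of [B]. *)
move=> mufin m1 eps0 c0 tail cJ; pose D := [set j | B `&` cell eps j !=set0].
have mc := measurable_cell eps.
rewrite partition_sum_esum//.
apply: le_trans (convolution_esum_le (r := m^-1)
  (u := fun j => fine (mu (cell eps j))) (D := D) _ _ _); last 3 first.
- by rewrite invr_gt0 (lt_trans _ m1).
- by move=> j; rewrite fine_ge0.
- by move=> j [x [/cJ Bx jx]]; exact: cell_sum_ge jx Bx.
rewrite (@eq_esum _ _ _ _ (fun j => ((c / 2) `^ m^-1 / 3)%:E * mu (cell eps j)));
  last by move=> j _; rewrite EFinM fineK// mufin.
rewrite ge0_esumZl ?divr_ge0 ?powR_ge0//.
rewrite lee_wpmul2l ?lee_fin ?divr_ge0 ?powR_ge0//.
rewrite -measure_bigcup_esum//; last exact: trivIset_cell.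
have mU : measurable (\bigcup_(j in D) cell eps j).
  rewrite bigcup_mkcond; apply: countable_bigcupT_measurable => [//|i].
  by case: ifP.
rewrite -[leRHS](measurable_mu_extE mu)//; apply: le_mu_ext => x Bx.
have jx := cell_floor x eps0.
by exists (Num.floor (x / eps)%R) => //; exists x.
Qed.

Lemma partition_sum_interpolation (R : realType)
    (mu : {measure set (measurableTypeR R) -> \bar R}) (r q l eps : R) :
  fin_num_fun mu -> (0 < r)%R -> (1 + r <= q)%R -> (0 < l)%R -> (0 < eps)%R ->
  partition_sum mu (1 + r) eps <=
  l%:E * mu setT + (l `^ (- ((q - (1 + r)) / r)))%:E * partition_sum mu q eps.
Proof.
move=> mufin r0 rq l0 eps0; have mc := measurable_cell eps.
rewrite -(bigcup_cell eps0) measure_bigcup_esum//; last exact: trivIset_cell.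
rewrite !partition_sum_esum// -!ge0_esumZl ?powR_ge0 ?(ltW l0)//.
rewrite -esumD; last 2 first.
- by move=> j _; rewrite mule_ge0// lee_fin ltW.
- by move=> j _; rewrite mule_ge0// lee_fin powR_ge0.
apply: le_esum => j _; rewrite -[mu (cell eps j)]fineK ?mufin//=.
by rewrite -!EFinM -EFinD lee_fin powR_interpolation// fine_ge0.
Qed.

(* B need not be shown measurable: only its outer measure is used. *)
Lemma borel_transform_uniform_lower (R : realType)
    (mu : {measure set (measurableTypeR R) -> \bar R}) (m s : R)
    (A : set (measurableTypeR R)) : measurable A -> 0 < mu A ->
  (forall x : R, A x -> 0 < limf_einf
     (fun eps : R => (eps `^ (- s))%:E * borel_transform mu m x eps) 0%R^'+) ->
  exists (l : R) (B : set (measurableTypeR R)), [/\ (0 < l)%R, 0 < mu_ext mu B &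
    forall x eps, B x -> (0 < eps < l)%R ->
      (l * eps `^ s)%:E <= borel_transform mu m x eps].
Proof.
move=> mA muA hA.
(* One parameter 1/(k+1) serves both as the constant and as the range of scales, so countably many
   sets suffice to cover [A]. *)
pose B (k : nat) := [set x : measurableTypeR R | forall eps, (0 < eps < k.+1%:R^-1)%R ->
  (k.+1%:R^-1 * eps `^ s)%:E <= borel_transform mu m x eps].
have AB : A `<=` \bigcup_k B k.
  move=> x /hA; rewrite limf_einfE => /ereal_sup_gt[_ [V V0 <-]].
  move=> inf_gt0.
  have [i i0 iV] : exists2 i : R, (0 < i)%R & forall eps, V eps ->
      i%:E <= (eps `^ (- s))%:E * borel_transform mu m x eps.
    have iV i : i <= ereal_inf
        [set (eps `^ (- s))%:E * borel_transform mu m x eps | eps in V] ->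
      forall eps, V eps -> i <= (eps `^ (- s))%:E * borel_transform mu m x eps.
      by move=> /le_trans iV eps Veps; apply: iV; apply: ereal_inf_lbound; exists eps.
    (* The infimum may be infinite; any positive real then works, and 1 is taken. *)
    case: (ereal_inf _) inf_gt0 iV => [i| |] // i0 iV.
      by exists i => //; apply: iV.
    by exists 1%R => //; apply: iV; exact: leey.
  case: V0 => /= e e0 eV.
  have [k kei] : exists k, (k.+1%:R^-1 < Num.min e i)%R.
    have /ltr_add_invr : (0 < Num.min e i)%R by rewrite lt_min e0 i0.
    by move=> [k]; rewrite add0r; exists k.
  move: kei; rewrite lt_min => /andP[ke ki].
  exists k => // eps /andP[eps0 epsk].
  have Veps : V eps.
    apply: eV => //=; rewrite sub0r normrN gtr0_norm//.
    exact: lt_trans ke.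
  have := iV _ Veps; rewrite powRN => h.
  apply: (@le_trans _ _ (i * eps `^ s)%:E).
    by rewrite lee_fin ler_wpM2r ?powR_ge0// ltW.
  by rewrite mulrC EFinM -lee_pdivlMl ?powR_gt0.
(* If every [B k] had outer measure zero, countable subadditivity would make [A] null. *)
have [k Bk] : exists k, 0 < mu_ext mu (B k).
  apply: contrapT => /forallNP B0.
  have : mu A <= 0.
    rewrite -(measurable_mu_extE mu mA).
    apply: le_trans (le_mu_ext mu AB) _.
    apply: le_trans (outer_measure_sigma_subadditive (mu_ext mu) _) _.
    rewrite eseries0// => k _ _; apply/eqP.
    by rewrite eq_le mu_ext_ge0// andbT leNgt; apply/negP; exact: B0.
  by rewrite leNgt muA.
by exists k.+1%:R^-1%R, (B k); split=> // x eps; exact.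
Qed.

(** With n the integer part of a^(1/m)/eps, (n+1)^m >= a/eps^m >= a/eps^s because eps < 1 and s < m;
    [a] is what the tail bound then requires. The extra 1 in the witness pays for the passage from n
    to n+1, as 1 <= 1/eps. *)
Lemma tail_cutoff (R : realType) (m s l M : R) : (1 < m)%R -> (s < 1)%R ->
  (0 < l)%R -> (0 < M)%R ->
  exists2 b : R, (0 < b)%R & forall eps, (0 < eps < 1)%R ->
    exists n : nat, (n.+1%:R <= b / eps)%R /\
      (3 `^ m * (n.+1%:R `^ (- m) * M) <= l * eps `^ s / 2)%R.
Proof.
move=> m1 s1 l0 M0; have m0 : (0 < m)%R by exact: lt_trans m1.
pose a := (2 * 3 `^ m * M / l)%R.
have a0 : (0 < a)%R by rewrite divr_gt0// !mulr_gt0// powR_gt0.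
exists (a `^ m^-1 + 1)%R; first by rewrite ltr_wpDl ?powR_ge0.
move=> eps /andP[eps0 eps1].
have q0 : (0 <= a `^ m^-1 / eps)%R by rewrite divr_ge0 ?powR_ge0// ltW.
exists (Num.truncn (a `^ m^-1 / eps)).
have /andP[n1 n2] := truncn_itv q0; set n := Num.truncn _ in n1 n2 *.
split.
  by rewrite -natr1 mulrDl lerD// mul1r invf_ge1// ltW.
have : (a / eps `^ s <= n.+1%:R `^ m)%R.
  apply: le_trans (_ : (a `^ m^-1 / eps) `^ m <= _)%R; last first.
    by apply: ge0_ler_powR; rewrite ?nnegrE// ltW.
  rewrite powRM ?powR_ge0 ?invr_ge0 ?(ltW eps0)//.
  rewrite -powRrM mulVf ?gt_eqF// powRr1 ?(ltW a0)// ler_wpM2l ?(ltW a0)//.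
  rewrite -[(eps^-1)%R]powR_inv1 ?(ltW eps0)// -powRrM mulN1r powRN.
  rewrite lef_pV2 ?posrE ?powR_gt0//.
  by apply: ger_powR; [rewrite eps0 ltW|exact: ltW (lt_trans s1 m1)].
rewrite powRN; set N := (n.+1%:R `^ m)%R; have N0 : (0 < N)%R by rewrite powR_gt0.
rewrite ler_pdivrMr ?powR_gt0// /a ler_pdivrMr// => h.
rewrite mulrCA ler_pdivrMl//; lra.
Qed.

Lemma partition_sum_lower_bound (R : realType)
    (mu : {measure set (measurableTypeR R) -> \bar R}) (m s l q : R)
    (B : set (measurableTypeR R)) :
  fin_num_fun mu -> (1 < m)%R -> (s < 1)%R -> (0 < l)%R ->
  (1 + m^-1 <= q)%R -> 0 < mu_ext mu B ->
  (forall x eps, B x -> (0 < eps < l)%R ->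
      (l * eps `^ s)%:E <= borel_transform mu m x eps) ->
  exists C K M : R, [/\ (0 < C)%R, (0 < K)%R, (0 < M)%R &
    forall eps, (0 < eps < l)%R -> (eps < 1)%R ->
      ((C * eps `^ (s / m) / (K - ln eps)) `^ ((q - 1) * m) * M)%:E <=
      partition_sum mu q eps].
Proof.
move=> mufin m1 s1 l0 qm B0 lB; have m0 : (0 < m)%R by exact: lt_trans m1.
have r0 : (0 < m^-1)%R by rewrite invr_gt0.
have muT : mu setT = (fine (mu setT))%:E by rewrite fineK// mufin.
have Bfin : mu_ext mu B \is a fin_num.
  rewrite ge0_fin_numE ?mu_ext_ge0// (@le_lt_trans _ _ (mu setT))//; last first.
    by rewrite muT ltry.
  by rewrite -(measurable_mu_extE mu)//; exact: le_mu_ext.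
set M := fine (mu setT) in muT *; set w := fine (mu_ext mu B).
have w0 : (0 < w)%R by rewrite fine_gt0// B0 ltey_eq Bfin.
have M0 : (0 < M)%R.
  rewrite -lte_fin -muT; apply: lt_le_trans B0 _.
  by rewrite -(measurable_mu_extE mu)//; exact: le_mu_ext.
have [b b0 tail] := tail_cutoff m1 s1 l0 M0.
(* The factor 24 is 3 * 4 * 2: the first two come from [partition_sum_ge], and the 2 makes the
   linear interpolation term at most half of the partition sum of exponent 1 + 1/m. *)
pose C := ((l / 2) `^ m^-1 * w / (24 * M))%R.
have C0 : (0 < C)%R by rewrite divr_gt0 ?mulr_gt0 ?powR_gt0 ?divr_gt0.
(* [K] is chosen so that K - ln eps dominates 1 + ln(b/eps), hence the harmonic sum; the absolute
   value keeps it positive. *)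
exists C, (1 + `|ln b|)%R, M; split=> // eps epsl eps1.
have eps0 : (0 < eps)%R by case/andP: epsl.
have [n [nb ntail]] : exists n : nat, (n.+1%:R <= b / eps)%R /\
    (3 `^ m * (n.+1%:R `^ (- m) * M) <= l * eps `^ s / 2)%R.
  by apply: tail; rewrite eps0.
set h := (1 + `|ln b| - ln eps)%R.
have h0 : (0 < h)%R.
  by rewrite /h -addrA ltr_wpDr// subr_ge0 (le_trans (ln_le0 (ltW eps1)))// .
have Hh : (\sum_(e < n) e.+1%:R^-1 <= h)%R.
  apply: (@le_trans _ _ (\sum_(e < n.+1) e.+1%:R^-1)%R).
    by rewrite big_ord_recr/= lerDl.
  apply: le_trans (harmonic_sum_le _ _) _; rewrite /h -addrA lerD2l.
  have : (ln n.+1%:R <= ln (b / eps))%R by rewrite ler_ln ?posrE// divr_gt0.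
  rewrite ln_div ?posrE// => /le_trans; apply.
  by rewrite lerD2r ler_norm.
have epsS0 : (0 < l * eps `^ s)%R by rewrite mulr_gt0 ?powR_gt0.
have := partition_sum_ge mufin m1 eps0 epsS0 ntail (fun x Bx => lB x eps Bx epsl).
set lam := (C * eps `^ (s / m) / h)%R.
have lam0 : (0 < lam)%R by rewrite divr_gt0// mulr_gt0// powR_gt0.
have S0 q' : 0 <= partition_sum mu q' eps.
  by apply: esum_ge0 => j _; exact: poweR_ge0.
have := partition_sum_interpolation mufin r0 qm lam0 eps0.
have := S0 q; case: (partition_sum mu q eps) => [z| |]//;
  last by move=> _ _ _; exact: leey.
rewrite lee_fin => z0; rewrite muT -!EFinM -EFinD.
have := S0 (1 + m^-1)%R; case: (partition_sum mu _ eps) => [y| |]// y0.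
rewrite -(fineK Bfin) -!EFinM !lee_fin -/w => yz wy.
(* One factor [lam] comes from the linear term and p of them from the interpolation weight, so the
   final exponent is p + 1. *)
have -> : ((q - 1) * m = (q - (1 + m^-1)) / m^-1 + 1)%R.
  by rewrite invrK; field; rewrite gt_eqF.
set p := ((q - (1 + m^-1)) / m^-1)%R in yz *.
rewrite powRD; last by rewrite (gt_eqF lam0) implybT.
rewrite powRr1 ?(ltW lam0)//.
have lamE : (8 * (h * (lam * M)) = (l * eps `^ s / 2) `^ m^-1 / 3 * w)%R.
  rewrite (_ : (l * eps `^ s / 2 = l / 2 * eps `^ s)%R); last by lra.
  rewrite powRM ?powR_ge0 ?divr_ge0 ?(ltW l0)// -powRrM /lam /C.
  by field; rewrite !gt_eqF.
have hy : (2 * (lam * M) <= y)%R.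
  have : (h * (2 * (lam * M)) <= h * y)%R.
    have := ler_wpM2r y0 Hh; rewrite lee_fin in y0.
    lra.
  by rewrite ler_pM2l.
have : (lam * M <= lam `^ (- p) * z)%R by lra.
by rewrite powRN ler_pdivlMl ?powR_gt0// mulrA.
Qed.

(** * Logarithmic asymptotics and the dimension bound *)

Lemma ln_le_linear (R : realType) (a x : R) : (0 < a)%R -> (0 < x)%R ->
  (ln x <= a * x - ln a)%R.
Proof.
move=> a0 x0; rewrite -(lerD2r (ln a)) subrK -lnM ?posrE// mulrC ltW//.
by rewrite ln_sublinear// mulr_gt0.
Qed.

(** The slack d is split in two halves through [a]: one absorbs ln(K - ln eps), which is bounded
    linearly, the other the constants gathered in [Q], once -ln eps is at least |Q|/(P a). *)
Lemma powR_log_lower (R : realType) (m s q d C K M : R) :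
  (0 < m)%R -> (1 < q)%R -> (0 < d)%R -> (0 < C)%R -> (0 < K)%R -> (0 < M)%R ->
  exists2 e : R, (0 < e)%R & forall eps, (0 < eps < e)%R -> (eps < 1)%R ->
    ((q - 1) * (s + d) * ln eps <=
     ln ((C * eps `^ (s / m) / (K - ln eps)) `^ ((q - 1) * m) * M))%R.
Proof.
move=> m0 q1 d0 C0 K0 M0; pose a := (d / (2 * m))%R.
have a0 : (0 < a)%R by rewrite divr_gt0// mulr_gt0.
pose P := ((q - 1) * m)%R; have P0 : (0 < P)%R by rewrite mulr_gt0// subr_gt0.
pose Q := (P * (ln C - a * K + ln a) + ln M)%R.
exists (expR (- (`|Q| / (P * a)))); first exact: expR_gt0.
move=> eps /andP[eps0 epse] eps1; set L := (- ln eps)%R.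
have KL0 : (0 < K + L)%R.
  by rewrite ltr_wpDr// oppr_ge0 (ln_le0 (ltW eps1)).
have QL : (0 <= Q + P * a * L)%R.
  have : (`|Q| / (P * a) <= L)%R.
    rewrite /L lerNr -[leRHS]expRK ler_ln ?posrE ?expR_gt0//.
    exact: ltW.
  rewrite ler_pdivrMr; last exact: mulr_gt0.
  move=> h; have := ler_norm (- Q)%R.
  by rewrite normrN; lra.
rewrite lnM ?posrE ?powR_gt0 ?divr_gt0 ?mulr_gt0 ?powR_gt0// ln_powR.
rewrite ln_div ?posrE ?mulr_gt0 ?powR_gt0// lnM ?posrE ?powR_gt0// ln_powR -/P.
have -> : ((q - 1) * (s + d) * ln eps = - (P * (s / m + 2 * a) * L))%R.
  by rewrite /P /a /L; field; rewrite (gt_eqF m0).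
have := ler_wpM2l (ltW P0) (ln_le_linear a0 KL0).
have -> : (ln eps = - L)%R by rewrite opprK.
by move: QL; rewrite /Q; lra.
Qed.

Theorem theorem1p7 (R : realType)
    (mu : {finite_measure set (measurableTypeR R) -> \bar R})
    (mu_cont : continuous_measure mu)
    (m s : R) (m_gt1 : (1 < m)%R) (s_lt1 : (s < 1)%R) (s_gt0 : (0 < s)%R)
    (hA : exists A : set (measurableTypeR R),
        [/\ measurable A, 0 < mu A &
            forall x : R, A x ->
              0 < limf_einf
                    (fun eps : R => (eps `^ (- s))%:E * borel_transform mu m x eps)
                    0%R^'+]) :
  forall q : R, (1 + m^-1 <= q)%R -> upper_multifractal_dim mu q <= s%:E.
Proof.
move=> q qm; have m0 : (0 < m)%R by exact: lt_trans m_gt1.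
have q1 : (1 < q)%R by rewrite (lt_le_trans _ qm)// ltrDl invr_gt0.
have [A [mA muA hA']] := hA.
have [l [B [l0 B0 lB]]] := borel_transform_uniform_lower mA muA hA'.
have mufin : fin_num_fun (mu : {measure set (measurableTypeR R) -> \bar R}).
  by move=> U mU; exact: fin_num_measure.
have [C [K [M [C0 K0 M0 lower]]]] :=
  partition_sum_lower_bound mufin m_gt1 s_lt1 l0 qm B0 lB.
(* It suffices to reach s + d for every d > 0, which leaves room for the logarithmic factor. *)
apply/lee_addgt0Pr => d d0.
have [e e0 he] := powR_log_lower s m0 q1 d0 C0 K0 M0.
rewrite /upper_multifractal_dim limf_esupE.
pose V := [set eps : R | (0 < eps < Num.min (Num.min e l) 1)%R].
have V0 : (0^'+)%R V.
  near=> eps; rewrite /V/=; apply/andP; split=> //.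
  near: eps; apply: nbhs_right_lt.
  by rewrite !lt_min e0 l0 ltr01.
apply: le_trans (ereal_inf_lbound _) _; first by exists V.
apply: ge_ereal_sup => _ [eps Veps <-].
move: Veps; rewrite /V/= !lt_min => /and3P[eps0 /andP[epse epsl] eps1].
have c0 : ((q - 1) * ln eps < 0)%R.
  by rewrite pmulr_rlt0 ?subr_gt0// ln_lt0// eps0.
(* The denominator is negative, so dividing reverses the order and the lower bound on the partition
   sum becomes an upper bound on the quotient. *)
rewrite inver lt_eqF// -EFinD lee_ndivrMr// -EFinM.
have eps_e : (0 < eps < e)%R by rewrite eps0.
have eps_l : (0 < eps < l)%R by rewrite eps0.
have lowerS := lower _ eps_l eps1.
set X := (_ `^ _ * M)%R in lowerS.
have X0 : (0 < X)%R.
  rewrite mulr_gt0// powR_gt0// divr_gt0 ?mulr_gt0 ?powR_gt0//.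
  by rewrite ltr_wpDr// oppr_ge0 ln_le0// ltW.
apply: (@le_trans _ _ (lne X%:E)).
  rewrite lne_EFin// lee_fin; apply: le_trans (he _ eps_e eps1).
  by rewrite mulrCA mulrA.
rewrite lee_lne// in_itv/= leey andbT.
  by rewrite lee_fin ltW.
by apply: le_trans lowerS; rewrite lee_fin ltW.
Unshelve. all: by end_near. Qed.
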